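(* Let $n,k\ge0$. For every $(S_1,S_2)\in\mathcal{C}_n^k$ the rook placement procedure in the context produces a well-defined placement of $n+k+1$ non-attacking rooks giving a permutation in $\mathcal{E}_n^k$, and the resulting map $\mathcal{C}_n^k\to\mathcal{E}_n^k$ is a bijection.
   Context: Colored symbols $i^r$ (red), $j^b$ (blue), compared within a color by value. $\mathcal{C}_n^k$: pairs of possibly empty strings $(S_1,S_2)$ using each of $1^r,\dots,n^r,1^b,\dots,k^b$ exactly once in total, with $S_1$ (if nonempty) starting blue, $S_2$ (if nonempty) starting red, every maximal same-colored run decreasing. $\mathcal{E}_n^k$: permutations $\lambda$ of $[n+k+1]$ with $\{i:\lambda(i)>i\}=\{1,\dots,n\}$; $\lambda$ is identified with the placement of rooks on an $(n+k+1)\times(n+k+1)$ board in column $i$ (from the left) and row $\lambda(i)$ (from the bottom). Labels: columns $1,\dots,n+k+1$ (left to right) are labeled $n^r,(n-1)^r,\dots,1^r,k^b,\dots,1^b,0^b$; rows from top to bottom are labeled $1^b,2^b,\dots,k^b,0^r,1^r,\dots,n^r$ (so row $\lambda$-value $n+k+1$ is $1^b$ and row value $1$ is $n^r$). Procedure: set $S=S_1\,0^b\,S_2\,0^r=x_1x_2\cdots x_{n+k+2}$. (1) For each pair of adjacent letters of the same color in $S$: if it is $x^ry^r$ place a rook in row $y^r$, column $x^r$; if it is $x^by^b$ place a rook in row $x^b$, column $y^b$. (2) Then for $i=1,2,\dots,n+k+1$ in order: if column $x_i$ already contains a rook, do nothing; otherwise place a rook in column $x_i$ in the topmost row among the rooks-free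 rows whose label has the color different from that of $x_i$. *)

(* Defs.v *)
From mathcomp Require Import all_boot all_fingroup.
Set Implicit Arguments.
Unset Strict Implicit.
Unset Printing Implicit Defensive.

(* A colored symbol is a pair of a color (true for red, false for blue) and a
   value. *)
Notation letter := (bool * nat)%type.
Definition red (i : nat) : letter := (true, i).
Definition blue (j : nat) : letter := (false, j).
Definition color (x : letter) : bool := x.1.
Definition value (x : letter) : nat := x.2.

(* The maximal same-colored runs of a string, from left to right. *)
Fixpoint runs (s : seq letter) : seq (seq letter) :=
  if s is x :: s' then
    match runs s' with
    | (y :: r) :: rs =>
        if color x == color y then (x :: y :: r) :: rs
        else [:: x] :: (y :: r) :: rs
    | rs => [:: x] :: rs
    end
  else [::].

Definition decreasing (r : seq letter) : bool :=
  sorted (fun x y => value y < value x) r.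

Definition starts_with_color (c : bool) (s : seq letter) : bool :=
  if s is x :: _ then color x == c else true.

Definition is_C (n k : nat) (S : seq letter * seq letter) : bool :=
  [&& perm_eq (S.1 ++ S.2)
        ([seq red i | i <- iota 1 n] ++ [seq blue j | j <- iota 1 k]),
      starts_with_color (color (blue 0)) S.1,
      starts_with_color (color (red 0)) S.2,
      all decreasing (runs S.1)
    & all decreasing (runs S.2)].

Definition C (n k : nat) := {S : seq letter * seq letter | is_C n k S}.

(* [n + k + 1] is represented by 'I_(n + k).+1, shifted down by one, so
   {1, ..., n} becomes the set of ordinals i < n. *)
Definition is_E (n k : nat) (lambda : 'S_((n + k).+1)) : bool :=
  [set i : 'I_((n + k).+1) | i < lambda i] == [set i : 'I_((n + k).+1) | i < n].
Arguments is_E n k lambda : clear implicits.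

Definition E (n k : nat) := {lambda : 'S_((n + k).+1) | is_E n k lambda}.

(* Columns are listed from left to right, rows from top to bottom. *)
Definition col_labels (n k : nat) : seq letter :=
  [seq red i | i <- rev (iota 1 n)] ++ [seq blue j | j <- rev (iota 0 k.+1)].
Definition row_labels (n k : nat) : seq letter :=
  [seq blue j | j <- iota 1 k] ++ [seq red i | i <- iota 0 n.+1].

(* A rook is recorded as (label of its column, label of its row), and a
   placement as the list of its rooks in the order they are placed. *)
Notation rook := (letter * letter)%type.

Definition nonattacking (R : seq rook) : bool :=
  uniq (map fst R) && uniq (map snd R).

(* The rooks of a permutation: rows are numbered from the bottom, hence the
   reversal of the top-to-bottom list of row labels. *)
Definition rooks_of_perm (n k : nat) (lambda : 'S_((n + k).+1)) : seq rook :=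
  [seq (nth (red 0) (col_labels n k) i,
        nth (red 0) (rev (row_labels n k)) (lambda i))
  | i : 'I_((n + k).+1) <- enum 'I_((n + k).+1)].
Arguments rooks_of_perm n k lambda : clear implicits.

Definition full_string (S : seq letter * seq letter) : seq letter :=
  S.1 ++ blue 0 :: S.2 ++ [:: red 0].

Definition adjacent_rook (xy : letter * letter) : option rook :=
  let: (x, y) := xy in
  if color x == color y then
    Some (if color x == color (red 0) then (x, y) else (y, x))
  else None.

Definition step1 (s : seq letter) : seq rook :=
  pmap adjacent_rook (zip s (behead s)).

(* None when the column of x is empty but no row is available for it. *)
Definition place_rook (n k : nat) (R : seq rook) (x : letter) :
    option (seq rook) :=
  if x \in map fst R then Some R
  else omap (fun y => rcons R (x, y))
         (ohead [seq y <- row_labels n k |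
                  (y \notin map snd R) && (color y != color x)]).

Definition step2 (n k : nat) (R : seq rook) (xs : seq letter) :
    option (seq rook) :=
  foldl (fun oR x => obind (fun R' => place_rook n k R' x) oR) (Some R) xs.

Definition rook_placement (n k : nat) (S : seq letter * seq letter) :
    option (seq rook) :=
  step2 n k (step1 (full_string S)) (take (n + k).+1 (full_string S)).

(* Main.v *)
(* Write [s] for the full string [S.1 0^b S.2 0^r], and let [sigma] send the
   label of a column to the label of the row of its rook, completed by
   [sigma 0^r = 0^b]. Iterating [sigma] from a letter [x] as long as the color
   does not change, one runs through the rest of the maximal run of [x] in [s]
   (rightwards if [x] is red, leftwards if it is blue) and then leaves it through
   a row of the other color. The second step of the procedure fills these rows
   from top to bottom, so the position of the exit row among all exit rows of
   its color (with [0^b] last) is the index of the blue-red block of [s]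
   containing [x]. Hence [s] lists all letters sorted by block, then color, then
   number of iterations before the exit (decreasing for red letters, increasing
   for blue ones), which proves injectivity. Conversely, starting from any
   permutation in [E], sorting the letters by this key gives a word whose rooks
   are the given ones. *)
Require Import Defs.
From mathcomp Require Import all_boot all_fingroup.
From mathcomp Require Import zify.
Set Implicit Arguments.
Unset Strict Implicit.
Unset Printing Implicit Defensive.

(** * Words *)

(** Comparing only neighbours of equal color turns the decrease of all maximal runs into one
    sortedness condition on the string. *)
Definition descends (x y : letter) : bool :=
  (color x == color y) ==> (value y < value x).

Lemma runs_cons (x : letter) (s : seq letter) :
  exists r rs, runs (x :: s) = (x :: r) :: rs.
Proof.
rewrite /=; case: (runs s) => [|[|y r] rs]; try by do 2!eexists.
by case: ifP => _; do 2!eexists.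
Qed.

Lemma all_decreasing_runs (s : seq letter) :
  all decreasing (runs s) = sorted descends s.
Proof.
elim: s => [|x [|y s] IH] //.
have [r [rs E]] := runs_cons y s.
have -> : runs (x :: y :: s) =
    if color x == color y then (x :: y :: r) :: rs else [:: x] :: (y :: r) :: rs.
  by move: E; set t := y :: s => /= ->.
have -> : sorted descends (x :: y :: s) = descends x y && sorted descends (y :: s) by [].
rewrite -{}IH E /descends.
by case: (color x == color y); rewrite //= /decreasing /= andbA.
Qed.

(** Among these letters only [red 0] labels no column and only [blue 0] labels no row. *)
Definition all_letters (n k : nat) : seq letter :=
  rcons (col_labels n k) (red 0).

(** An intrinsic description of the full strings that does not mention the cut between [S.1] and
    [S.2]. *)
Definition is_word (n k : nat) (s : seq letter) : bool :=
  [&& perm_eq s (all_letters n k), starts_with_color false s,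
      last (red 0) s == red 0 & sorted descends s].

Lemma perm_all_letters (n k : nat) (s1 s2 : seq letter) :
  perm_eq (s1 ++ blue 0 :: s2 ++ [:: red 0]) (all_letters n k) =
  perm_eq (s1 ++ s2) ([seq red i | i <- iota 1 n] ++ [seq blue j | j <- iota 1 k]).
Proof.
have -> : perm_eq (s1 ++ blue 0 :: s2 ++ [:: red 0]) (all_letters n k) =
   perm_eq ([:: blue 0; red 0] ++ (s1 ++ s2)) (all_letters n k).
  apply: permPl; apply/seq.permP => p.
  by rewrite !count_cat /= !count_cat /=; lia.
have /permPr -> : perm_eq (all_letters n k) ([:: blue 0; red 0] ++
    ([seq red i | i <- iota 1 n] ++ [seq blue j | j <- iota 1 k])).
  rewrite /all_letters /col_labels -cats1; apply/seq.permP => p.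
  rewrite !count_cat !map_rev !count_rev /= (iotaDl 1 0) /=; lia.
by rewrite perm_cat2l.
Qed.

(** The letters of [S.1] and [S.2] have positive values, so descending into [blue 0] or [red 0] is
    automatic. Nothing blue lies below [blue 0], so descending out of it forces a red letter, which
    is the start condition on [S.2]. *)
Lemma is_word_full_string (n k : nat) (S : seq letter * seq letter) :
  is_C n k S = is_word n k (full_string S).
Proof.
case: S => s1 s2; rewrite /is_C /is_word /full_string /= perm_all_letters.
case P : (perm_eq _ _) => //=.
have pos x : x \in s1 ++ s2 -> 0 < value x.
  by rewrite (perm_mem P) mem_cat => /orP[] /mapP[i]; rewrite mem_iota => ? -> /=; lia.
rewrite !all_decreasing_runs last_cat /= last_cat /=.
have -> : starts_with_color false (s1 ++ blue 0 :: s2 ++ [:: red 0]) =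
          starts_with_color (color (blue 0)) s1 by case: (s1).
case: (starts_with_color (color (blue 0)) s1) => //=.
have -> : sorted descends (s1 ++ blue 0 :: s2 ++ [:: red 0]) =
   sorted descends s1 && path descends (blue 0) (s2 ++ [:: red 0]).
  case: s1 pos {P} => [|x s1] pos //=; rewrite cat_path /=; congr (_ && _).
  have -> // : descends (last x s1) (blue 0).
  apply/implyP => _; apply: pos; rewrite mem_cat mem_last //.
rewrite andbCA; congr (_ && _).
case: s2 pos {P} => [|x s2] pos //=; rewrite cat_path /= andbT.
have -> : descends (last x s2) (red 0).
  by apply/implyP => _; apply: pos; rewrite mem_cat mem_last orbT.
rewrite andbT; congr (_ && _); rewrite /descends /=.
by case: (color x).
Qed.

Lemma full_string_inj (n k : nat) (S T : seq letter * seq letter) :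
  is_C n k S -> is_C n k T -> full_string S = full_string T -> S = T.
Proof.
move=> CS CT E.
(* An explicit inverse: [blue 0] does not occur in [S.1], so its first occurrence marks the cut; the
   double reversal strips the final [red 0]. *)
have U (V : seq letter * seq letter) : is_C n k V ->
    V = (take (index (blue 0) (full_string V)) (full_string V),
         rev (behead (rev (behead (drop (index (blue 0) (full_string V)) (full_string V)))))).
  case: V => s1 s2 /and5P[/perm_mem P _ _ _ _]; rewrite /full_string /=.
  have N : blue 0 \notin s1.
    apply/negP => H; have: blue 0 \in s1 ++ s2 by rewrite mem_cat H.
    rewrite P mem_cat => /orP[] /mapP[i]; rewrite mem_iota => // H2 [] E0; lia.
  rewrite index_cat (negPf N) /= addn0 take_size_cat // drop_size_cat //=.
  by rewrite rev_cat /= revK.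
by rewrite (U S CS) (U T CT) E.
Qed.

Lemma is_word_full_stringP (n k : nat) (s : seq letter) :
  is_word n k s -> exists2 S, is_C n k S & full_string S = s.
Proof.
move=> W.
suff [S E] : exists S, full_string S = s by exists S => //; rewrite is_word_full_string E.
have /and4P[P _ L _] := W.
have : blue 0 \in s.
  by rewrite (perm_mem P) mem_rcons inE mem_cat map_f ?orbT // mem_rev mem_iota.
move=> b0; case/splitPr: b0 L {W P} => s1 s2.
rewrite last_cat /=; case/lastP: s2 => [|s2 x] //=; rewrite last_rcons => /eqP ->.
by exists (s1, s2); rewrite /full_string cats1.
Qed.

(** The membership test matters: the index of an absent letter is the size of [s], which is one more
    than the index of a last letter occurring once. *)
Definition consecutive (s : seq letter) (x y : letter) : bool :=
  (y \in s) && (index y s == (index x s).+1).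

Lemma mem_zip_behead (s : seq letter) (x y : letter) :
  uniq s -> ((x, y) \in zip s (behead s)) = consecutive s x y.
Proof.
rewrite /consecutive; elim: s => [|a t IH] // /andP[at_ ut].
have -> : ((x, y) \in zip (a :: t) (behead (a :: t))) =
    ((x == a) && (t != [::]) && (y == head a t)) || ((x, y) \in zip t (behead t)).
  by case: (t) => [|b t'] /=; rewrite ?andbF // inE xpair_eqE andbT.
rewrite {}IH // [y \in a :: t]inE /= (eq_sym a x) (eq_sym a y).
have [->|xa] := eqVneq x a => /=.
  have [->|ya] /= := eqVneq y a.
    rewrite (negPf at_) orbF; case: (t) at_ => // b t'; rewrite inE negb_or /=.
    by case: eqP.
  rewrite (memNindex at_); case: (boolP (y \in t)) => yt /=.
    have -> : (index y t == (size t).+1) = false by apply: ltn_eqF; rewrite ltnS index_size.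
    by rewrite orbF eqSS; case: (t) yt => //= b t' _; rewrite (eq_sym b); case: (y == b).
  by rewrite orbF; case: (t) yt => //= b t'; rewrite inE; case: (y == b).

have [->|ya] //= := eqVneq y a.
by rewrite (negPf at_).
Qed.

Lemma sorted_consecutive (e : rel letter) (s : seq letter) : uniq s ->
  sorted e s <-> (forall x y, consecutive s x y -> e x y).
Proof.
move=> us.
suff -> : sorted e s = all (fun p => e p.1 p.2) (zip s (behead s)).
  split=> [/allP H x y|H].
    by rewrite -mem_zip_behead // => /H.
  by apply/allP => -[x y]; rewrite mem_zip_behead //; apply: H.
by elim: (s) => [|x [|y t] IH] //=; rewrite -IH.
Qed.

Lemma consecutive_mem (s : seq letter) (x y : letter) :
  consecutive s x y -> (x \in s) && (y \in s).
Proof.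
case/andP=> ys /eqP E; rewrite ys andbT -index_mem.
by move: ys; rewrite -index_mem E => /ltnW.
Qed.

Lemma consecutive_funr (s : seq letter) (x y z : letter) :
  consecutive s x y -> consecutive s x z -> y = z.
Proof.
move=> /andP[ys /eqP E] /andP[_ /eqP F].
by rewrite -(nth_index y ys) E -F nth_index // -index_mem F -E index_mem.
Qed.

Lemma consecutive_funl (s : seq letter) (x y z : letter) :
  consecutive s x z -> consecutive s y z -> x = y.
Proof.
move=> H G; have /andP[xs _] := consecutive_mem H.
have /andP[ys _] := consecutive_mem G.
move: H G => /andP[_ /eqP E] /andP[_ /eqP F].
have {}E : index x s = index y s by lia.
by rewrite -(nth_index x xs) E nth_index.
Qed.

(** The swap that [adjacent_rook] performs on blue pairs amounts to reading adjacency backwards. *)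
Lemma mem_step1 (s : seq letter) (x y : letter) : uniq s ->
  ((x, y) \in step1 s) =
  (color x == color y) && (if color x then consecutive s x y else consecutive s y x).
Proof.
move=> us; rewrite /step1 mem_pmap; apply/mapP/idP.
  case=> -[a b]; rewrite mem_zip_behead // => H /=; case: eqP => // E.
  by case Ea: (color a == _) => -[-> ->]; rewrite -E eqxx;
    move: Ea; case: (color a).
move=> /andP[/eqP E H]; exists (if color x then (x, y) else (y, x)).
  by case: (color x) H; rewrite mem_zip_behead.
by rewrite /adjacent_rook; case Ex: (color x); rewrite -E Ex.
Qed.

(** In a duplicate-free word a letter has at most one successor and one predecessor, so no two of
    these rooks attack each other. *)
Lemma uniq_step1 (s : seq letter) : uniq s ->
  uniq (map fst (step1 s)) && uniq (map snd (step1 s)).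
Proof.
move=> us.
have u1 : uniq (step1 s).
  (* The partial inverse swaps the blue rooks back into adjacent pairs. *)
  apply: (pmap_uniq (g := fun p => if color p.1 then p else (p.2, p.1))); last exact: zip_uniql.
  move=> [x y] /=; case: eqP => //= E.
  by case: (color x =P true) E => /= [-> //|]; case: (color x) => //= _ <-.
apply/andP; split; rewrite map_inj_in_uniq //.
  move=> [x y] [a z] /=; rewrite !mem_step1 // => + + E; rewrite -{a}E.
  case/andP=> _ H /andP[_ G]; congr pair; case: (color x) H G.
    exact: consecutive_funr.
  exact: consecutive_funl.
move=> [x y] [z a] /=; rewrite !mem_step1 // => + + E; rewrite -{a}E.
case/andP=> /eqP E1 + /andP[/eqP E2]; rewrite E1 E2 => H G; congr pair; case: (color y) H G.
  exact: consecutive_funl.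
exact: consecutive_funr.
Qed.

(** * The greedy step *)

Lemma mem_labels (c : bool) (x : letter) (s : seq nat) :
  (x \in [seq (c, i) | i <- s]) = (color x == c) && (value x \in s).
Proof.
apply/mapP/andP => [[i si ->]|[/eqP <- xs]]; first by rewrite /= eqxx.
by exists (value x) => //; case: x {xs}.
Qed.

Lemma mem_col_labels (n k : nat) (x : letter) :
  (x \in col_labels n k) = if color x then 0 < value x <= n else value x <= k.
Proof.
rewrite mem_cat !mem_labels !mem_rev !mem_iota.
by case: (color x) => /=; rewrite ?orbF; lia.
Qed.

Lemma mem_row_labels (n k : nat) (x : letter) :
  (x \in row_labels n k) = if color x then value x <= n else 0 < value x <= k.
Proof.
rewrite mem_cat !mem_labels !mem_iota.
by case: (color x) => /=; rewrite ?orbF; lia.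
Qed.

Lemma mem_all_letters (n k : nat) (x : letter) :
  (x \in all_letters n k) = if color x then value x <= n else value x <= k.
Proof.
rewrite mem_rcons inE mem_col_labels.
by case: x => -[] v; rewrite xpair_eqE /=; lia.
Qed.

Lemma uniq_col_labels (n k : nat) : uniq (col_labels n k).
Proof.
rewrite cat_uniq !map_inj_uniq ?rev_uniq ?iota_uniq //=; try by move=> i j [].
by rewrite andbT; apply/hasPn => x; rewrite !mem_labels; case: (color x).
Qed.

Lemma uniq_row_labels (n k : nat) : uniq (row_labels n k).
Proof.
rewrite cat_uniq !map_inj_uniq ?iota_uniq; try by move=> i j [].
by rewrite andbT; apply/hasPn => x; rewrite !mem_labels; case: (color x).
Qed.

Lemma uniq_all_letters (n k : nat) : uniq (all_letters n k).
Proof. by rewrite rcons_uniq mem_col_labels uniq_col_labels. Qed.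

Lemma perm_row_labels (n k : nat) :
  perm_eq (all_letters n k) (rcons (row_labels n k) (blue 0)).
Proof.
apply: uniq_perm; rewrite ?uniq_all_letters ?rcons_uniq ?uniq_row_labels ?mem_row_labels //.
move=> x; rewrite mem_all_letters mem_rcons inE mem_row_labels.
by case: x => -[] v; rewrite xpair_eqE /=; lia.
Qed.

Lemma size_row_labels (n k : nat) : size (row_labels n k) = (n + k).+1.
Proof. by rewrite size_cat !size_map !size_iota; lia. Qed.

Lemma size_col_labels (n k : nat) : size (col_labels n k) = (n + k).+1.
Proof. by rewrite size_cat !size_map !size_rev !size_iota; lia. Qed.

Definition empty_cols (R : seq rook) (c : bool) (xs : seq letter) : seq letter :=
  [seq x <- xs | (x \notin map fst R) && (color x == c)].

Arguments empty_cols : simpl never.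

(** Here [c] is the color of the columns to be filled, hence the rows of the other color. *)
Definition free_rows (n k : nat) (R : seq rook) (c : bool) : seq letter :=
  [seq y <- row_labels n k | (y \notin map snd R) && (color y != c)].

(** Red and blue columns draw on disjoint stocks of rows, and each placement takes the head of its
    stock. The loop therefore zips, for each color, the empty columns with the free rows. *)
Lemma step2_greedy (n k : nat) (R : seq rook) (xs : seq letter) :
  uniq xs ->
  (forall c, size (empty_cols R c xs) <= size (free_rows n k R c)) ->
  exists2 R', step2 n k R xs = Some R' &
    perm_eq R' (R ++ zip (empty_cols R true xs) (free_rows n k R true)
                  ++ zip (empty_cols R false xs) (free_rows n k R false)).
Proof.
elim: xs R => [|x xs IH] R => [_ _|/andP[xxs uxs] H].
  have z t : zip (@nil letter) t = [::] :> seq rook by case: t.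
  by exists R; rewrite // !z /= cats0.
have -> : step2 n k R (x :: xs) =
    foldl (fun oR x => obind (fun R' => place_rook n k R' x) oR) (place_rook n k R x) xs by [].
rewrite /place_rook.
case: ifP => xR.
  have E c : empty_cols R c (x :: xs) = empty_cols R c xs by rewrite /empty_cols /= xR.
  have [|R' e P] := IH R uxs; first by move=> c; rewrite -E.
  by exists R'; rewrite ?E.
set c := color x.
rewrite -/(free_rows n k R c).
have E1 : empty_cols R c (x :: xs) = x :: empty_cols R c xs.
  by rewrite /empty_cols /= xR eqxx.
have E2 : empty_cols R (~~ c) (x :: xs) = empty_cols R (~~ c) xs.
  by rewrite /empty_cols /= xR /= -/c; case: (c).
have := H c; rewrite E1; case F : (free_rows n k R c) => [|y ys] //= Hc.
have /(filter_uniq (fun y => (y \notin map snd R) && (color y != c))) := uniq_row_labels n k.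
rewrite -/(free_rows n k R c) F /= => /andP[yys uys].
have yR : y \in free_rows n k R c by rewrite F mem_head.
have cy : color y = ~~ c.
  by move: yR; rewrite mem_filter => /andP[/andP[_]]; case: (color y) (c) => [] [].
(* The new rook removes the head of the stock of color [c] and, by [G2], leaves the other stock
   unchanged. *)
have G1 : free_rows n k (rcons R (x, y)) c = ys.
  transitivity [seq z <- ys | z != y]; last first.
    by apply/all_filterP/allP => z zys; apply: contraNneq yys => <-.
  have -> : [seq z <- ys | z != y] = [seq z <- y :: ys | z != y] by rewrite /= eqxx.
  rewrite -F -filter_predI; apply: eq_filter => z /=.
  by rewrite map_rcons mem_rcons inE negb_or andbA.
have G2 : free_rows n k (rcons R (x, y)) (~~ c) = free_rows n k R (~~ c).
  apply: eq_filter => z; rewrite map_rcons mem_rcons inE negb_or /= -cy.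
  by case: (eqVneq z y) => [->|]; rewrite ?eqxx ?andbF.
have D d : empty_cols (rcons R (x, y)) d xs = empty_cols R d xs.
  apply: eq_in_filter => z zxs; rewrite map_rcons mem_rcons inE negb_or /=.
  by case: (eqVneq z x) zxs => // ->; rewrite (negPf xxs).
have [|R' e P] := IH (rcons R (x, y)) uxs.
  move=> d; rewrite D; case: (eqVneq d c) => [->|dc]; first by rewrite G1; lia.
  have -> : d = ~~ c by case: (d) (c) dc => [] [].
  by rewrite G2 -E2; apply: H.
exists R'; first exact: e.
apply: (perm_trans P); rewrite !D.
clear - E1 E2 G1 G2 F; clearbody c; case: c E1 E2 G1 G2 F => E1 E2 G1 G2 F;
  rewrite E1 E2 G1 G2 F cat_rcons perm_cat2l //.
by rewrite -[(x, y) :: zip _ _ ++ _]cat1s perm_catCA.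
Qed.

Lemma perm_cat_filter_notin (T : eqType) (s t : seq T) :
  uniq s -> uniq t -> {subset t <= s} ->
  perm_eq (t ++ [seq x <- s | x \notin t]) s.
Proof.
move=> us ut ts; apply: uniq_perm => // [|x].
  rewrite cat_uniq ut filter_uniq // andbT; apply/hasPn => x.
  by rewrite mem_filter => /andP[].
rewrite mem_cat mem_filter; case: (boolP (x \in t)) => // /ts ->.
by [].
Qed.

Lemma mem_zip (T U : eqType) (s : seq T) (t : seq U) (x : T) (y : U) :
  (x, y) \in zip s t -> (x \in s) && (y \in t).
Proof.
elim: s t => [|a s IH] [|b t] //=; rewrite !inE => /orP[/eqP[-> ->]|/IH /andP[-> ->]].
  by rewrite !eqxx.
by rewrite !orbT.
Qed.

Lemma is_word_rcons (n k : nat) (s : seq letter) :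
  is_word n k s -> exists2 s', s = rcons s' (red 0) & perm_eq s' (col_labels n k).
Proof.
case/and4P => P _ L _; case/lastP: s P L => [|s x] P.
  by have := perm_size P; rewrite size_rcons.
rewrite last_rcons => /eqP E; rewrite {}E in P *; exists s => //.
by move: P; rewrite /all_letters -!cats1 perm_cat2r.
Qed.

(** * Legal squares, and the balance between empty columns and free rows *)

Lemma count_step1 (c : bool) (s : seq letter) :
  count (fun r => color r.1 == c) (step1 s) =
    count (fun p => (color p.1 == c) && (color p.2 == c)) (zip s (behead s)) /\
  count (fun r => color r.2 == c) (step1 s) =
    count (fun p => (color p.1 == c) && (color p.2 == c)) (zip s (behead s)).
Proof.
rewrite /step1; elim: (zip _ _) => [|[x y] Z [IH1 IH2]] //=.
by case: x y => [[] a] [[] b] /=; rewrite ?IH1 ?IH2 //; case: c {IH1 IH2} => /=; lia.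
Qed.

(** The excedance condition read on labels: strictly above the diagonal in a red column, weakly
    below it in a blue one. Labels of different colors always satisfy it. *)
Definition legal (xy : rook) : bool :=
  (color xy.1 == color xy.2) ==>
  (if color xy.1 then value xy.2 < value xy.1 else value xy.1 < value xy.2).

(** These are the rook placements of the permutations in [E n k], expressed through labels. *)
Definition valid (n k : nat) (R : seq rook) : bool :=
  [&& perm_eq (map fst R) (col_labels n k), perm_eq (map snd R) (row_labels n k)
    & all legal R].

Lemma legal_step1 (n k : nat) (s : seq letter) :
  is_word n k s -> all legal (step1 s).
Proof.
case/and4P => P _ _ D; have us : uniq s by rewrite (perm_uniq P) uniq_all_letters.
apply/allP => -[x y]; rewrite mem_step1 // => /andP[E].
move/(sorted_consecutive _ us): D => D; rewrite /legal /= E /=.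
by case: ifP => _ /D; rewrite /descends ?E // eq_sym E.
Qed.

(** Legality makes the value of a red column in a monochromatic rook positive, which excludes
    [red 0]; [rows_step1] excludes [blue 0] as a row in the same way. *)
Lemma cols_step1 (n k : nat) (s : seq letter) :
  is_word n k s -> {subset map fst (step1 s) <= col_labels n k}.
Proof.
move=> W; have /and4P [P _ _ _] := W.
have us : uniq s by rewrite (perm_uniq P) uniq_all_letters.
move=> x /mapP[[{}x y] xy /= ->]; have /allP/(_ _ xy) := legal_step1 W.
rewrite mem_step1 // /legal /= in xy *; case/andP: xy => -> /=.
rewrite mem_col_labels; case E: (color x) => /consecutive_mem /andP[];
  rewrite !(perm_mem P) => m1 m2; [move: m1 | move: m2];
  rewrite mem_all_letters E; lia.
Qed.

Lemma rows_step1 (n k : nat) (s : seq letter) :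
  is_word n k s -> {subset map snd (step1 s) <= row_labels n k}.
Proof.
move=> W; have /and4P [P _ _ _] := W.
have us : uniq s by rewrite (perm_uniq P) uniq_all_letters.
move=> y /mapP[[x {}y] xy /= ->]; have /allP/(_ _ xy) := legal_step1 W.
rewrite mem_step1 // /legal /= in xy *; case/andP: xy => /eqP -> /=; rewrite eqxx /=.
rewrite mem_row_labels; case E: (color y) => /consecutive_mem /andP[];
  rewrite !(perm_mem P) => m1 m2; [move: m2 | move: m1];
  rewrite mem_all_letters E; lia.
Qed.

Lemma count_col_labels (c : bool) (n k : nat) :
  count (fun x => color x == c) (col_labels n k) = if c then n else k.+1.
Proof.
rewrite count_cat !count_map !count_rev.
transitivity (count (fun=> c) (iota 1 n) + count (fun=> ~~ c) (iota 0 k.+1)).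
  by congr (_ + _); apply: eq_count => i; case: c.
by case: c; rewrite ?count_predT ?count_pred0 !size_iota ?addn0.
Qed.

Lemma count_row_labels (c : bool) (n k : nat) :
  count (fun x => color x == c) (row_labels n k) = if c then n.+1 else k.
Proof.
rewrite count_cat !count_map.
transitivity (count (fun=> ~~ c) (iota 1 k) + count (fun=> c) (iota 0 n.+1)).
  by congr (_ + _); apply: eq_count => i; case: c.
by case: c; rewrite ?count_predT ?count_pred0 !size_iota ?addn0.
Qed.

Lemma unzip1_behead (T : Type) (s : seq T) (x : T) :
  unzip1 (zip (rcons s x) (behead (rcons s x))) = s.
Proof.
case: s => // a s; elim: s a => [|b s IH] a //=.
by congr cons; apply: IH.
Qed.

(** Both sides count every pair that is not blue-red exactly once. *)
Lemma count_color_changes (Z : seq (letter * letter)) :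
  count (fun p => color p.1 == true) Z +
    count (fun p => (color p.1 == false) && (color p.2 == false)) Z =
  count (fun p => color p.2 == false) Z +
    count (fun p => (color p.1 == true) && (color p.2 == true)) Z.
Proof. by elim: Z => [|[[[] a] [[] b]] Z IH] //=; lia. Qed.

(** Each monochromatic pair uses up one column and one row of its color. Subtracting from the color
    totals reduces the equality to [count_color_changes]. *)
Lemma size_empty_cols (n k : nat) (s : seq letter) (c : bool) :
  is_word n k s ->
  size (empty_cols (step1 s) c (take (n + k).+1 s)) = size (free_rows n k (step1 s) c).
Proof.
move=> W; have [s' Es Ps] := is_word_rcons W.
have -> : take (n + k).+1 s = s'.
  by rewrite -(size_col_labels n k) -(perm_size Ps) Es -cats1 take_size_cat.
have /and4P [P B _ _] := W.
have us : uniq s by rewrite (perm_uniq P) uniq_all_letters.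
have us' : uniq s' by rewrite (perm_uniq Ps) uniq_col_labels.
have /andP[uc ur] := uniq_step1 us.
have HC d : size (empty_cols (step1 s) d s') +
    count (fun p => (color p.1 == d) && (color p.2 == d)) (zip s (behead s)) =
    if d then n else k.+1.
  rewrite -(count_step1 d s).1 -(count_col_labels d n k).
  rewrite -((seq.permP Ps) (fun x => color x == d)).
  have sub : {subset map fst (step1 s) <= s'}.
    by move=> x /(cols_step1 W); rewrite (perm_mem Ps).
  rewrite -((seq.permP (perm_cat_filter_notin us' uc sub)) (fun x => color x == d)).
  rewrite count_cat count_map count_filter addnC; congr (_ + _).
  by rewrite size_filter; apply: eq_count => x /=; rewrite andbC.
have HR d : size (free_rows n k (step1 s) d) +
    count (fun p => (color p.1 == ~~ d) && (color p.2 == ~~ d)) (zip s (behead s)) =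
    if d then k else n.+1.
  rewrite -(count_step1 (~~ d) s).2.
  have -> : (if d then k else n.+1) = if ~~ d then n.+1 else k by case: d.
  rewrite -(count_row_labels (~~ d) n k).
  have PR := perm_cat_filter_notin (uniq_row_labels n k) ur (rows_step1 W).
  rewrite -(seq.permP PR (fun x => color x == ~~ d)).
  rewrite count_cat count_map count_filter addnC; congr (_ + _).
  rewrite size_filter; apply: eq_count => x /=; rewrite andbC; congr andb.
  by case: (color x) (d) => [] [].
have := count_color_changes (zip s (behead s)).
(* Every letter but the final [red 0] comes first in a pair, leaving [n] red ones; every letter but
   the blue initial one comes second, leaving [k] blue ones. *)
have -> : count (fun p => color p.1 == true) (zip s (behead s)) = n.
  rewrite -(count_map fst (fun x => color x == true)) Es [map _ _]unzip1_behead.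
  by rewrite (seq.permP Ps) count_col_labels.
have -> : count (fun p => color p.2 == false) (zip s (behead s)) = k.
  rewrite -(count_map snd (fun x => color x == false)) [map _ _]unzip2_zip ?size_behead ?leq_pred //.
  have := seq.permP P (fun x => color x == false).
  rewrite /all_letters -cats1 count_cat count_col_labels /=.
  by case: (s) B => [|x t] //= ->; lia.
by have := HC c; have := HR c; case: c => /=; lia.
Qed.

(** The zipped lists have equal sizes, so no row or column is lost. Rooks of the second step join
    labels of different colors and are legal for that reason. *)
Lemma word_placement (n k : nat) (s : seq letter) (R0 := step1 s)
    (s' := take (n + k).+1 s) : is_word n k s ->
  exists R, [/\ step2 n k R0 s' = Some R,
    perm_eq R (R0 ++ zip (empty_cols R0 true s') (free_rows n k R0 true)
                  ++ zip (empty_cols R0 false s') (free_rows n k R0 false))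
    & valid n k R].
Proof.
move=> W; have sz c : size (empty_cols R0 c s') = size (free_rows n k R0 c).
  exact: size_empty_cols.
have /and4P [P _ _ _] := W.
have us : uniq s by rewrite (perm_uniq P) uniq_all_letters.
have us' : uniq s' by rewrite take_uniq.
have /andP[uc ur] := uniq_step1 us.
have Ps : perm_eq s' (col_labels n k).
  have [t Et Pt] := is_word_rcons W.
  by rewrite /s' -(size_col_labels n k) -(perm_size Pt) Et -cats1 take_size_cat.
have split (p : pred letter) t : perm_eq [seq x <- t | p x]
   ([seq x <- t | p x && (color x == true)] ++ [seq x <- t | p x && (color x == false)]).
  apply/seq.permP => q; rewrite count_cat !count_filter.
  by elim: t => //= x t ->; case: (color x) (p x) (q x) => [] [] []; rewrite /= ?addnS.
have [|R e PR] := @step2_greedy n k R0 s' us'; first by move=> c; rewrite sz.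
exists R; split => //; apply/and3P; split.
- rewrite (permPl (perm_map _ PR)) !map_cat ![map _ (zip _ _)]unzip1_zip ?sz //.
  rewrite -(permPr Ps).
  have sub : {subset map fst R0 <= s'} by move=> x /(cols_step1 W); rewrite (perm_mem Ps).
  rewrite -(permPr (perm_cat_filter_notin us' uc sub)) perm_cat2l perm_sym.
  exact: split.
- rewrite (permPl (perm_map _ PR)) !map_cat ![map _ (zip _ _)]unzip2_zip ?sz //.
  rewrite -(permPr (perm_cat_filter_notin (uniq_row_labels n k) ur (rows_step1 W))).
  rewrite perm_cat2l perm_catC perm_sym (permPl (split _ _)).
  have E c : free_rows n k R0 c =
      [seq y <- row_labels n k | (y \notin map snd R0) && (color y == ~~ c)].
    by apply: eq_filter => y; congr andb; case: (color y) (c) => [] [].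
  by rewrite !E.
- rewrite (perm_all _ PR) !all_cat (legal_step1 W) /=.
  apply/andP; split; apply/allP => -[x y] /mem_zip /andP[];
  rewrite !mem_filter => /andP[/andP[_ /eqP E] _] /andP[/andP[_ H] _];
  by rewrite /legal /= E eq_sym (negPf H).
Qed.

(** * Runs and exits of a rook placement *)

Section Keys.

Variables (n k : nat) (sigma : letter -> letter).

Let L := all_letters n k.

(** Completing the column-to-row map at [red 0] makes it a permutation of the letters. *)
Definition good : Prop :=
  [/\ {in L, forall x, sigma x \in L}, {in L &, injective sigma},
      sigma (red 0) = blue 0 & {in L, forall x, legal (x, sigma x)}].

Definition crossing (x : letter) : bool := color (sigma x) != color x.

(* A step that keeps the color is monotone in the value, so [n + k + 1] units of
   fuel always suffice on the letters in use. *)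
Fixpoint walk (fuel : nat) (x : letter) : letter * nat :=
  if fuel is fuel'.+1 then
    if crossing x then (sigma x, 0)
    else ((walk fuel' (sigma x)).1, (walk fuel' (sigma x)).2.+1)
  else (sigma x, 0).

Definition exit (x : letter) : letter := (walk (n + k).+1 x).1.
Definition depth (x : letter) : nat := (walk (n + k).+1 x).2.

(* [blue 0] is listed last: it is the exit of the last red run. *)
Definition exits (c : bool) : seq letter :=
  [seq y <- rcons (row_labels n k) (blue 0) |
    (color y == c) && has (fun x => crossing x && (sigma x == y)) L].

Definition rank (x : letter) : nat := index (exit x) (exits (~~ color x)).

(** Doubling the rank and adding the color encodes the lexicographic order on rank and color, with
    blue before red. *)
Definition key_le (x y : letter) : bool :=
  ((rank x).*2 + color x < (rank y).*2 + color y) ||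
  ((rank x).*2 + color x == (rank y).*2 + color y) &&
  (if color x then depth y <= depth x else depth x <= depth y).

Lemma key_le_refl : reflexive key_le.
Proof. by move=> x; rewrite /key_le; case: (color x); lia. Qed.

Lemma key_le_total : total key_le.
Proof. by move=> x y; rewrite /key_le; case: (color x); case: (color y); lia. Qed.

Lemma key_le_trans : transitive key_le.
Proof.
move=> y x z; rewrite /key_le; case: (color x); case: (color y); case: (color z) => /=; lia.
Qed.

Hypothesis sigma_good : good.

(** By legality red values fall and blue values rise along noncrossing steps, so [h] bounds the
    number of such steps. *)
Lemma walk_fuel (f g : nat) (x : letter) (h := if color x then value x else k - value x) :
  x \in L -> h < f -> h < g -> walk f x = walk g x.
Proof.
rewrite {}/h; have [sL _ _ sl] := sigma_good.
elim: f g x => [|f IH] [|g] x xL //=; rewrite ?ltn0 // => hf hg.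
case: ifP => // /negbFE/eqP E.
rewrite (IH g) // ?sL //.
all: have := sl x xL; have := xL; have := sL x xL.
all: rewrite /legal /= !mem_all_letters !E eqxx /=; case: (color x) hf hg; lia.
Qed.

Lemma exit_crossing (x : letter) : crossing x -> exit x = sigma x.
Proof. by rewrite /exit /= => ->. Qed.

Lemma depth_crossing (x : letter) : crossing x -> depth x = 0.
Proof. by rewrite /depth /= => ->. Qed.

Lemma walk_step (x : letter) : x \in L -> ~~ crossing x ->
  walk (n + k).+1 x = (exit (sigma x), (depth (sigma x)).+1).
Proof.
move=> xL cx; have [sL _ _ sl] := sigma_good.
rewrite /exit /depth [LHS]/= (negPf cx).
(* After one noncrossing step the measure is below [n + k], so the spent unit of fuel can be
   restored. *)
rewrite (@walk_fuel (n + k) (n + k).+1) ?sL //.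
all: have := sl x xL; have := xL; have := sL x xL; move/negbNE/eqP: cx => E.
all: rewrite /legal /= !mem_all_letters !E eqxx /=; case: (color x); lia.
Qed.

Lemma rank_step (x : letter) : x \in L -> ~~ crossing x -> rank x = rank (sigma x).
Proof.
move=> xL cx; rewrite /rank {1}/exit walk_step //=.
by move/negbNE/eqP: cx => ->.
Qed.

Lemma depth_step (x : letter) : x \in L -> ~~ crossing x -> depth x = (depth (sigma x)).+1.
Proof. by move=> xL cx; rewrite {1}/depth walk_step. Qed.

Lemma mem_exits (x : letter) : x \in L -> crossing x -> sigma x \in exits (~~ color x).
Proof.
have [sL _ _ _] := sigma_good.
move=> xL cx; rewrite mem_filter -(perm_mem (perm_row_labels n k)) sL // andbT.
apply/andP; split; first by move: cx; rewrite /crossing; case: (color _) (color x) => [] [].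
by apply/hasP; exists x; rewrite ?cx ?eqxx.
Qed.

Lemma uniq_exits (c : bool) : uniq (exits c).
Proof. by apply: filter_uniq; rewrite -(perm_uniq (perm_row_labels n k)) uniq_all_letters. Qed.

Lemma exit_mem (x : letter) : x \in L -> exit x \in exits (~~ color x).
Proof.
have [sL _ _ _] := sigma_good.
move D: (depth x) => d; elim: d x D => [|d IH] x D xL; case: (boolP (crossing x)) => cx.
- by rewrite exit_crossing // mem_exits.
- by rewrite depth_step in D.
- by rewrite depth_crossing in D.
rewrite {1}/exit walk_step //=.
rewrite depth_step // in D; case: D => D.
have := IH _ D (sL _ xL); by move/negbNE/eqP: cx => ->.
Qed.

Lemma rank_lt (x : letter) : x \in L -> rank x < size (exits (~~ color x)).
Proof. by move=> xL; rewrite index_mem exit_mem. Qed.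

(** Equal depths let both letters walk to their exits in parallel. Equal ranks identify the exits,
    and injectivity of [sigma] carries the equality back. *)
Lemma key_inj (x y : letter) : x \in L -> y \in L ->
  color x = color y -> rank x = rank y -> depth x = depth y -> x = y.
Proof.
have [sL si _ _] := sigma_good.
move D: (depth x) => d; elim: d x y D => [|d IH] x y D xL yL C R Dy;
  case: (boolP (crossing x)) => cx; case: (boolP (crossing y)) => cy;
  rewrite ?(depth_step _ cx) ?(depth_step _ cy) ?(depth_crossing cx) ?(depth_crossing cy) // in D Dy.
- apply: si => //; move: R; rewrite /rank !exit_crossing // C => E.
  have mx := mem_exits xL cx; have my := mem_exits yL cy; rewrite C in mx.
  by rewrite -(nth_index (blue 0) mx) E nth_index.
- apply: si => //; apply: IH; rewrite ?sL //; try lia.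
    by rewrite (eqP (negbNE cx)) (eqP (negbNE cy)).
  by rewrite -!rank_step.
Qed.

Lemma key_le_anti (x y : letter) : x \in L -> y \in L -> key_le x y -> key_le y x -> x = y.
Proof.
move=> xL yL xy yx; have [cE rE dE] : [/\ color x = color y, rank x = rank y & depth x = depth y].
  by move: xy yx; rewrite /key_le; case: (color x); case: (color y) => /= xy yx; split; lia.
exact: key_inj.
Qed.

Lemma rank_onto (c : bool) (i : nat) : i < size (exits c) ->
  exists x, [/\ x \in L, crossing x, color x = ~~ c, sigma x = nth (blue 0) (exits c) i & rank x = i].
Proof.
move=> ic; have := mem_nth (blue 0) ic.
rewrite mem_filter => /andP[/andP[/eqP C /hasP[x xL /andP[cx /eqP E]]] _].
have cE : color x = ~~ c.
  by move: cx; rewrite /crossing E C; case: (color x) (c) => [] [].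
exists x; split=> //; rewrite /rank exit_crossing // cE negbK E index_uniq //.
exact: uniq_exits.
Qed.

Lemma perm_exits (c : bool) :
  perm_eq (exits c) (map sigma [seq x <- L | crossing x && (color x == ~~ c)]).
Proof.
have [sL si _ _] := sigma_good.
apply: uniq_perm; first exact: uniq_exits.
  rewrite map_inj_in_uniq ?filter_uniq ?uniq_all_letters //.
  by move=> x y; rewrite !mem_filter => /andP[_ xL] /andP[_ yL]; apply: si.
move=> y; apply/idP/mapP => [|[x]].
  rewrite mem_filter => /andP[/andP[/eqP C /hasP[x xL /andP[cx /eqP E]]] _].
  exists x => //; rewrite mem_filter cx xL andbT /=.
  by move: cx; rewrite /crossing E C; case: (color x) (c) => [] [].
rewrite mem_filter => /andP[/andP[cx /eqP E] xL] ->.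
by have := mem_exits xL cx; rewrite E negbK.
Qed.

Lemma perm_sigma : perm_eq (map sigma L) L.
Proof.
have [sL si _ _] := sigma_good.
have u : uniq (map sigma L) by rewrite map_inj_in_uniq ?uniq_all_letters.
apply: uniq_perm; rewrite ?uniq_all_letters //.
have /(uniq_min_size u) [] // : {subset map sigma L <= L} by move=> _ /mapP[x xL ->]; apply: sL.
by rewrite size_map.
Qed.

(* [sigma] permutes the letters, hence as many of them cross from red to blue
   as from blue to red. *)
Lemma size_exits : size (exits true) = size (exits false).
Proof.
rewrite !(perm_size (perm_exits _)) !size_map !size_filter.
have := seq.permP perm_sigma color; rewrite count_map.
suff H s : count (preim sigma color) s + count (fun x => crossing x && (color x == ~~ false)) s =
   count color s + count (fun x => crossing x && (color x == ~~ true)) s.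
  by move=> E; have := H L; rewrite E => /addnI /esym.
elim: s => [|x s IH] //=; rewrite /crossing in IH *.
by move: IH => /=; case: (color x); case: (color (sigma x)) => /=; lia.
Qed.

Lemma crossing_red0 : crossing (red 0).
Proof. by have [_ _ E _] := sigma_good; rewrite /crossing E. Qed.

(** The interface shared by both directions of the proof: it is established for a given word and for
    the sorted word separately. *)
Definition noncrossing_rooks (R0 : seq rook) : Prop :=
  forall x y, ((x, y) \in R0) = [&& x \in col_labels n k, ~~ crossing x & sigma x == y].

Variable R0 : seq rook.
Hypothesis R0_rooks : noncrossing_rooks R0.

Lemma mem_cols_noncrossing (x : letter) : x \in col_labels n k ->
  (x \in map fst R0) = ~~ crossing x.
Proof.
move=> xC; apply/mapP/idP => [[[z y] zy /= ->]|cx].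
  by move: zy; rewrite R0_rooks => /and3P[].
by exists (x, sigma x); rewrite // R0_rooks xC cx /=.
Qed.

(** The boolean [c] is read as a multiplicity: the crossing letter [red 0] closes the red list
    only. *)
Lemma filter_crossing (c : bool) (s : seq letter) : perm_eq s (col_labels n k) ->
  [seq x <- rcons s (red 0) | crossing x && (color x == c)] =
  empty_cols R0 c s ++ nseq c (red 0).
Proof.
move=> P; rewrite filter_rcons crossing_red0 /=.
have -> : [seq x <- s | crossing x && (color x == c)] = empty_cols R0 c s.
  apply: eq_in_filter => x; rewrite (perm_mem P) => xC.
  by rewrite mem_cols_noncrossing // negbK.
by case: c; rewrite /= ?cats0 ?cats1.
Qed.

(** A row stays free under the noncrossing rooks exactly when its preimage under [sigma] crosses.
    The extra [blue 0] is the image of [red 0]. *)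
Lemma exits_free_rows (c : bool) :
  exits c = free_rows n k R0 (~~ c) ++ nseq (~~ c) (blue 0).
Proof.
have [sL si s0 _] := sigma_good.
have r0L : red 0 \in L by rewrite mem_rcons mem_head.
rewrite /exits filter_rcons -cats1.
have -> : (color (blue 0) == c) && has (fun x => crossing x && (sigma x == blue 0)) L = ~~ c.
  by case: c => //=; apply/hasP; exists (red 0); rewrite // crossing_red0 s0 eqxx.
have -> : [seq y <- row_labels n k | (color y == c) &&
   has (fun x => crossing x && (sigma x == y)) L] = free_rows n k R0 (~~ c).
  apply: eq_in_filter => y yR; rewrite andbC.
  have -> : (color y == c) = (color y != ~~ c) by case: (color y) (c) => [] [].
  congr andb; have : y \in map sigma L.
    by rewrite (perm_mem perm_sigma) (perm_mem (perm_row_labels n k)) mem_rcons inE yR orbT.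
  case/mapP => x xL E; have xC : x \in col_labels n k.
    move: xL; rewrite mem_rcons inE => /orP[/eqP x0|//].
    by move: yR; rewrite E x0 s0 mem_row_labels.
  apply/hasP/negP => [[z zL /andP[cz /eqP zy]] /mapP[[a b]]|H].
    rewrite R0_rooks => /and3P[aC ca /eqP ab] /= yb.
    have za : z = a by apply: si; rewrite ?zy ?yb // mem_rcons inE aC orbT.
    by move: ca; rewrite -za cz.
  exists x; rewrite // E eqxx andbT; apply: contraT => cx.
  by case: H; apply/mapP; exists (x, y); rewrite // R0_rooks xC cx E /=.
by case: c => /=; rewrite ?cats0.
Qed.

End Keys.

(** * The string is determined by its placement *)

Lemma uniq_fst_inj (T U : eqType) (R : seq (T * U)) (x : T) (y z : U) :
  uniq (map fst R) -> (x, y) \in R -> (x, z) \in R -> y = z.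
Proof.
elim: R => [|[a b] R IH] //= /andP[aR uR]; rewrite !inE.
have N w : (a, w) \notin R by apply: contra aR => H; apply/mapP; exists (a, w).
case/orP=> [/eqP[-> ->]|xy]; case/orP=> [/eqP E|xz].
- by case: E.
- by move: xz; rewrite (negPf (N z)).
- by case: E xy => -> _; rewrite (negPf (N y)).
exact: IH.
Qed.

Lemma uniq_snd_inj (T U : eqType) (R : seq (T * U)) (x y : T) (z : U) :
  uniq (map snd R) -> (x, z) \in R -> (y, z) \in R -> x = y.
Proof.
elim: R => [|[a b] R IH] //= /andP[bR uR]; rewrite !inE.
have N w : (w, b) \notin R by apply: contra bR => H; apply/mapP; exists (w, b).
case/orP=> [/eqP[-> ->]|xz]; case/orP=> [/eqP E|yz].
- by case: E.
- by move: yz; rewrite (negPf (N y)).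
- by case: E xz => _ ->; rewrite (negPf (N x)).
exact: IH.
Qed.

Lemma map_zip (T U : eqType) (f : T -> U) (s : seq T) (t : seq U) :
  size s = size t -> (forall x y, (x, y) \in zip s t -> f x = y) -> map f s = t.
Proof.
elim: s t => [|x s IH] [|y t] //= [sz] H; rewrite (H x y) ?mem_head //; congr cons.
by apply: IH => // a b ab; apply: H; rewrite inE ab orbT.
Qed.

Lemma map_index_uniq (T : eqType) (s : seq T) :
  uniq s -> map (index^~ s) s = iota 0 (size s).
Proof.
move=> us; case: s us => // x0 s us.
apply: (@eq_from_nth _ 0) => [|i]; first by rewrite size_map size_iota.
rewrite size_map => si; rewrite (nth_map x0) // index_uniq // nth_iota //.
Qed.

Section WordKeys.

Variables (n k : nat) (sigma : letter -> letter).
Hypothesis sigma_good : good n k sigma.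

Local Notation rank := (rank n k sigma).
Local Notation depth := (depth n k sigma).
Local Notation crossing := (crossing sigma).
Local Notation key_le := (key_le n k sigma).

(** The trace of adjacency on [sigma]. A red-to-blue step separates two blocks, and both its letters
    cross; a blue-to-red step stays inside a block and asks for nothing. *)
Definition linked (x y : letter) : bool :=
  if color x == color y then
    if color x then ~~ crossing x && (sigma x == y) else ~~ crossing y && (sigma y == x)
  else color x ==> crossing x && crossing y.

(** Induction along the word, with [i] the index of the current block. A red run ends and a blue run
    begins with its crossing letter, so the index grows exactly at red-to-blue steps. The crossing
    letter of the current blue run is already consumed, so the blue ranks start at [i.+1] and a blue
    [x] needs its rank as a hypothesis. *)
Lemma linked_path (x : letter) (t : seq letter) (i a b : nat) :
  path linked x t -> {subset x :: t <= all_letters n k} ->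
  color (last x t) -> crossing (last x t) ->
  map rank [seq z <- x :: t | crossing z && (color z == true)] = iota i a ->
  map rank [seq z <- t | crossing z && (color z == false)] = iota i.+1 b ->
  (~~ color x -> rank x = i) ->
  path key_le x t /\ rank x = i.
Proof.
elim: t x i a b => [|y t IH] x i a b.
  by move=> _ _ /= -> -> /=; case: a => [|a] //= [->].
move=> /= /andP[xy P] sub cl kl Hr Hb Hx.
have xL : x \in all_letters n k by apply: sub; rewrite mem_head.
have yL : y \in all_letters n k by apply: sub; rewrite inE mem_head orbT.
have {}IH := IH y _ _ _ P (fun z zt => sub z (mem_behead (s := x :: y :: t) zt)) cl kl.
move: xy Hr Hb Hx; rewrite /linked.
have KS := rank_step sigma_good; have DS := depth_step sigma_good.
case: eqP => [cxy|/eqP cxy]; case Ex: (color x) => /=.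
- case/andP => [cx /eqP E]; rewrite (negPf cx) /= => Hr.
  have Ey : color y = true by rewrite -cxy.
  rewrite Ey !andbF => Hb _; have [|-> ry] := IH _ _ _ Hr Hb; first by rewrite Ey.
  have rx : rank x = i by rewrite (KS x) // E.
  split => //; rewrite andbT /key_le rx ry (DS x) // E Ex Ey; lia.
- case/andP => [cy /eqP E]; rewrite (negPf cy) !andbF /= => Hr Hb /(_ isT) rx.
  have ry : rank y = i by rewrite (KS y) // E.
  have Ey : color y = false by rewrite -cxy.
  have [||//|-> _] := IH i a b; rewrite /= ?(negPf cy) //.
  split => //; rewrite andbT /key_le rx ry (DS y) // E Ex Ey; lia.
- case/andP=> -> ->.
  have Ey : color y = false by move: cxy; rewrite Ex; case: (color y).
  rewrite Ey /=; case: a => [|a] //= [rx Hr]; case: b => [|b] //= [ry Hb] _.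
  have [||//|-> _] := IH i.+1 a b; rewrite /= ?Ey ?andbF //.
  split => //; rewrite andbT /key_le rx ry Ex Ey; lia.
- move=> _; rewrite andbF /= => Hr.
  have Ey : color y = true by move: cxy; rewrite Ex; case: (color y).
  rewrite Ey andbF => Hb /(_ isT) rx; have [//|//||-> ry] := IH i a b; rewrite ?Ey //.
  split => //; rewrite andbT /key_le rx ry Ex Ey; lia.
Qed.

Variables (s : seq letter) (R : seq rook).

Local Notation R0 := (step1 s).
Local Notation s' := (take (n + k).+1 s).

Hypothesis s_word : is_word n k s.
Hypothesis R_perm :
  perm_eq R (R0 ++ zip (empty_cols R0 true s') (free_rows n k R0 true)
                ++ zip (empty_cols R0 false s') (free_rows n k R0 false)).
Hypothesis R_valid : valid n k R.
Hypothesis R_sigma : forall x, x \in col_labels n k -> (x, sigma x) \in R.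

Let uniq_s : uniq s.
Proof. by case/and4P: s_word => P _ _ _; rewrite (perm_uniq P) uniq_all_letters. Qed.

Let mem_s : s =i all_letters n k.
Proof. by case/and4P: s_word => P _ _ _; apply: perm_mem. Qed.

Let s_rcons : s = rcons s' (red 0) /\ perm_eq s' (col_labels n k).
Proof.
have [t Et Pt] := is_word_rcons s_word.
by rewrite Et -(size_col_labels n k) -(perm_size Pt) -{2 3}cats1 take_size_cat.
Qed.

Lemma sigma_rook (x y : letter) : (x, y) \in R -> sigma x = y.
Proof.
move=> xy; have /and3P[PC _ _] := R_valid.
apply: (uniq_fst_inj _ (R_sigma _) xy); first by rewrite (perm_uniq PC) uniq_col_labels.
by rewrite -(perm_mem PC); apply/mapP; exists (x, y).
Qed.

(** First-step rooks join labels of one color and second-step rooks labels of different colors. *)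
Lemma step1_noncrossing : noncrossing_rooks n k sigma R0.
Proof.
move=> x y; apply/idP/and3P => [xy|[xC cx /eqP E]].
  have xR : (x, y) \in R by rewrite (perm_mem R_perm) mem_cat xy.
  have /and3P[PC _ _] := R_valid; rewrite /crossing (sigma_rook xR) eqxx; split=> //.
    by rewrite -(perm_mem PC); apply/mapP; exists (x, y).
  by move: xy; rewrite mem_step1 // => /andP[/eqP -> _]; rewrite eqxx.
have := R_sigma xC; rewrite (perm_mem R_perm) -E !mem_cat => /or3P[//||] /mem_zip /andP[];
  rewrite !mem_filter => /andP[/andP[_ /eqP C] _] /andP[/andP[_ F] _];
  by move: cx; rewrite /crossing C F.
Qed.

Lemma noncrossing_consecutive (x : letter) : x \in col_labels n k -> ~~ crossing x ->
  if color x then consecutive s x (sigma x) else consecutive s (sigma x) x.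
Proof.
move=> xC cx; have : (x, sigma x) \in R0 by rewrite step1_noncrossing xC cx /=.
by rewrite mem_step1 // => /andP[].
Qed.

Lemma red_or_col (x : letter) : x \in s -> x = red 0 \/ x \in col_labels n k.
Proof. by rewrite mem_s mem_rcons inE => /orP[/eqP|]; [left|right]. Qed.

(** In a red-to-blue pair a noncrossing letter would have its [sigma]-image, of its own color, as
    the other member of the pair. *)
Lemma linked_consecutive (x y : letter) : consecutive s x y -> linked x y.
Proof.
move=> xy; rewrite /linked; have /andP[xs ys] := consecutive_mem xy.
case: eqP => [E|/eqP ne]; last first.
  apply/implyP => cx; have cy : color y = false by move: ne; rewrite cx; case: (color y).
  apply/andP; split.
    have [->|xC] := red_or_col xs; first exact: (crossing_red0 sigma_good).
    apply: contraT => ncx; have := noncrossing_consecutive xC ncx; rewrite cx => H.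
    by case/negP: ncx; rewrite /crossing (consecutive_funr H xy) cx cy.
  have [e|yC] := red_or_col ys; first by rewrite e in cy.
  apply: contraT => ncy; have := noncrossing_consecutive yC ncy; rewrite cy => H.
  by case/negP: ncy; rewrite /crossing (consecutive_funl H xy) cx cy.
case cx: (color x).
  have H : (x, y) \in R by rewrite (perm_mem R_perm) mem_cat mem_step1 // E eqxx -E cx xy.
  by rewrite /crossing (sigma_rook H) E !eqxx.
have H : (y, x) \in R by rewrite (perm_mem R_perm) mem_cat mem_step1 // E eqxx -E cx xy.
by rewrite /crossing (sigma_rook H) E !eqxx.
Qed.

(** The greedy step hands the exits from top to bottom to the crossing letters in word order, so
    their ranks are successive. *)
Lemma map_rank_crossing (c : bool) :
  map rank [seq x <- s | crossing x && (color x == c)] = iota 0 (size (exits n k sigma (~~ c))).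
Proof.
have [_ _ s0 _] := sigma_good.
set A := [seq x <- s | _].
have H : map sigma A = exits n k sigma (~~ c).
  have -> : A = empty_cols R0 c s' ++ nseq c (red 0).
    rewrite -(filter_crossing sigma_good step1_noncrossing) ?s_rcons.2 //.
    by rewrite -s_rcons.1.
  rewrite (exits_free_rows sigma_good step1_noncrossing) negbK map_cat.
  congr (_ ++ _); last by case: (c); rewrite //= s0.
  apply: map_zip; first exact: size_empty_cols.
  move=> x y xy; apply: sigma_rook; rewrite (perm_mem R_perm) !mem_cat.
  by case: (c) xy => ->; rewrite !orbT.
rewrite -map_index_uniq ?uniq_exits // -[in RHS]H -map_comp.
apply/eq_in_map => x; rewrite mem_filter => /andP[/andP[cx /eqP E] xs] /=.
by rewrite /rank exit_crossing // E H.
Qed.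

Lemma word_sorted : sorted key_le s.
Proof.
have /(sorted_consecutive _ uniq_s) := linked_consecutive.
have /and4P[_ B /eqP L _] := s_word.
have Hr := map_rank_crossing true; have Hb := map_rank_crossing false.
(* A noncrossing blue letter has its image directly before it, so the initial blue letter crosses;
   it therefore gets rank 0 and starts the induction. *)
have noprev x : (x == head (red 0) s) -> ~~ color x -> x \in s -> crossing x.
  move=> /eqP xh cx xs; have [e|xC] := red_or_col xs; first by rewrite e in cx.
  apply: contraT => ncx; have := noncrossing_consecutive xC ncx; rewrite (negPf cx) xh.
  case/andP => hs; rewrite [X in X == _](_ : _ = 0) //.
  by move: hs; case: (s) => //= a t _; rewrite eqxx.
move: B L Hr Hb noprev mem_s; case: (s) => [|x t] //= /eqP cx L.
rewrite cx andbT andbF => Hr + /(_ x); rewrite eqxx mem_head cx => + /(_ isT isT isT) kx.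
rewrite kx /= => Hb M P.
case E : (size _) Hb => [|b] //= [rx Hb].
have Hr' : map rank [seq z <- x :: t | crossing z && (color z == true)] =
    iota 0 (size (exits n k sigma false)) by rewrite /= cx andbF.
have [||||//] := @linked_path x t 0 _ _ P _ _ _ Hr' Hb.
- by move=> z zs; rewrite -M.
- by rewrite L.
- by rewrite L (crossing_red0 sigma_good).
by [].
Qed.

End WordKeys.

(** * The string of a placement *)

Lemma zip_map_graph (T U : Type) (f : T -> U) (s : seq T) :
  zip s (map f s) = map (fun x => (x, f x)) s.
Proof. by elim: s => //= x s ->. Qed.

Section SortedWord.

Variables (n k : nat) (sigma : letter -> letter).
Hypothesis sigma_good : good n k sigma.

Local Notation L := (all_letters n k).
Local Notation rank := (rank n k sigma).
Local Notation depth := (depth n k sigma).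
Local Notation crossing := (crossing sigma).
Local Notation key_le := (key_le n k sigma).
Local Notation exits := (exits n k sigma).

Definition sorted_word : seq letter := sort key_le L.

Local Notation s := sorted_word.

Let perm_s : perm_eq s L.
Proof. by rewrite perm_sort. Qed.

Let uniq_s : uniq s.
Proof. by rewrite sort_uniq uniq_all_letters. Qed.

Let mem_s : s =i L.
Proof. exact: mem_sort. Qed.

Let sorted_s : sorted key_le s.
Proof. exact/sort_sorted/key_le_total. Qed.

Lemma index_key_le (x y : letter) : x \in L -> y \in L ->
  index x s <= index y s -> key_le x y.
Proof.
rewrite -!mem_s => xs ys.
apply: (sorted_leq_index _ _ sorted_s) => //; [exact: key_le_trans | exact: key_le_refl].
Qed.

(** The way adjacency is exploited below: a letter with a key strictly in between gives a
    contradiction. *)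
Lemma consecutive_between (x y w : letter) : consecutive s x y -> w \in L ->
  key_le w x \/ key_le y w.
Proof.
move=> xy wL; have /andP[] := consecutive_mem xy; rewrite !mem_s => xL yL.
case/andP: xy => _ /eqP E; case: (leqP (index w s) (index x s)) => H.
  by left; apply: index_key_le.
by right; apply: index_key_le; rewrite ?E.
Qed.

Lemma consecutive_key_le (x y : letter) : consecutive s x y -> key_le x y.
Proof.
move=> xy; have /andP[] := consecutive_mem xy; rewrite !mem_s => xL yL.
by apply: index_key_le => //; case/andP: xy => _ /eqP ->; apply: leqnSn.
Qed.

Lemma consecutive_rank (x y : letter) : consecutive s x y ->
  color x = color y -> rank x = rank y.
Proof.
move=> xy C; have /andP[] := consecutive_mem xy; rewrite !mem_s => xL yL.
have le := consecutive_key_le xy; have sz := size_exits sigma_good.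
have lx := rank_lt sigma_good xL; have ly := rank_lt sigma_good yL.
apply/eqP; rewrite eqn_leq; apply/andP; split.
  by move: le; rewrite /key_le C; case: (color y); lia.
rewrite leqNgt; apply/negP => lt.
(* Every block contains both colors, by [size_exits]. If [x] is red, a blue letter of the block of
   [y] separates the two; if [x] is blue, a red letter of its own block does. *)
have [w [wL wC wr]] : exists w, [/\ w \in L, color w = ~~ color x &
    rank w = if color x then rank y else rank x].
  have sc : size (exits (color x)) = size (exits (~~ color x)) by case: (color x).
  have [|w [wL _ wc _ wr]] := @rank_onto n k sigma (color x) (if color x then rank y else rank x).
    by move: lx ly; rewrite -C -sc; case: ifP.
  by exists w.
have := consecutive_between xy wL; rewrite /key_le wC wr -C; case: (color x) => /= -[]; lia.
Qed.

(** Distinct letters of equal color and rank differ in depth, so the deeper one does not cross. Its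
    image is one less deep, and nothing fits strictly between neighbours, so the image is the other
    letter. *)
Lemma consecutive_sigma (x y : letter) : consecutive s x y -> color x = color y ->
  if color x then ~~ crossing x /\ sigma x = y else ~~ crossing y /\ sigma y = x.
Proof.
have [sL _ _ _] := sigma_good.
move=> xy C; have /andP[] := consecutive_mem xy; rewrite !mem_s => xL yL.
have R := consecutive_rank xy C; have le := consecutive_key_le xy.
have xney : x <> y by move=> e; case/andP: xy => _; rewrite e; lia.
have dne : depth x != depth y by apply/eqP => /(key_inj sigma_good xL yL C R).
case cx: (color x).
  have nx : ~~ crossing x.
    apply/negP => /(@depth_crossing n k) dx; move: le; rewrite /key_le -C R cx dx; lia.
  split=> //; apply/esym; have wL := sL x xL; have wC := eqP (negbNE nx).
  have wR := rank_step sigma_good xL nx; have wD := depth_step sigma_good xL nx.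
  apply: (key_inj sigma_good) => //; rewrite -?C -?R ?wC //.
  have := consecutive_between xy wL; move: le.
  by rewrite /key_le wC -C cx -wR -R wD => le []; lia.
have ny : ~~ crossing y.
  apply/negP => /(@depth_crossing n k) dy; move: le; rewrite /key_le -C R cx dy; lia.
split=> //; have wL := sL y yL; have wC := eqP (negbNE ny).
have wR := rank_step sigma_good yL ny; have wD := depth_step sigma_good yL ny.
apply: (key_inj sigma_good) => //; rewrite -?C ?R ?wC ?C //.
have := consecutive_between xy wL; move: le.
by rewrite /key_le wC -C cx -wR -R wD => le []; lia.
Qed.

(** The successor of the earlier letter is squeezed between [x] and [sigma x], hence has their
    color, and [consecutive_sigma] identifies it; the blue case also needs injectivity of
    [sigma]. *)
Lemma sigma_consecutive (x : letter) : x \in L -> ~~ crossing x ->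
  if color x then consecutive s x (sigma x) else consecutive s (sigma x) x.
Proof.
have [sL si _ _] := sigma_good.
move=> xL cx; set y := sigma x; have yL : y \in L by apply: sL.
have C : color y = color x := eqP (negbNE cx).
have R := rank_step sigma_good xL cx; have D := depth_step sigma_good xL cx.
rewrite -/y in R D.
have next (a b : letter) : a \in L -> b \in L -> ~~ key_le b a ->
    exists z, consecutive s a z.
  move=> aL bL nba; have lt : index a s < index b s.
    by rewrite ltnNge; apply: contra nba; apply: index_key_le.
  have {}lt : (index a s).+1 < size s by apply: (leq_ltn_trans lt); rewrite index_mem mem_s.
  exists (nth a s (index a s).+1); by rewrite /consecutive mem_nth //= index_uniq //.
case: ifP => cc.
  have nyx : ~~ key_le y x by rewrite /key_le C R D cc; lia.
  have [z xz] := next x y xL yL nyx.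
  case: (consecutive_between xz yL) => [|zy]; first by rewrite (negPf nyx).
  have cz : color x = color z.
    have := consecutive_key_le xz; move: zy; rewrite /key_le C R cc; case: (color z) => //; lia.
  by have := consecutive_sigma xz cz; rewrite cc -/y => -[_ ->].
have nxy : ~~ key_le x y by rewrite /key_le C R D cc; lia.
have [z yz] := next y x yL xL nxy.
case: (consecutive_between yz xL) => [|zx]; first by rewrite (negPf nxy).
have cz : color y = color z.
  have := consecutive_key_le yz; move: zx; rewrite /key_le C R cc; case: (color z) => //; lia.
have := consecutive_sigma yz cz; rewrite C cc => -[_ E].
have zL : z \in L by rewrite -mem_s; case/andP: (consecutive_mem yz).
by rewrite -(si _ _ zL xL E).
Qed.

Lemma noncrossing_rooks_sorted : noncrossing_rooks n k sigma (step1 s).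
Proof.
have [sL _ s0 _] := sigma_good.
have sub x : x \in L -> ~~ crossing x -> x \in col_labels n k.
  rewrite mem_rcons inE => /orP[/eqP->|//]; by rewrite (crossing_red0 sigma_good).
move=> x y; rewrite mem_step1 //; apply/andP/and3P => [[/eqP C]|[xC cx /eqP <-]].
  case cx: (color x) => H; have := consecutive_mem H; rewrite !mem_s => /andP[m1 m2].
    by have := consecutive_sigma H C; rewrite cx => -[nc ->]; rewrite eqxx; split=> //; apply: sub.
  have := consecutive_sigma H (esym C); rewrite -C cx => -[nc ->].
  by rewrite eqxx; split=> //; apply: sub.
by rewrite eq_sym (negbNE cx) sigma_consecutive // mem_rcons inE xC orbT.
Qed.

Lemma sorted_word_is_word : is_word n k s.
Proof.
have [sL _ s0 sl] := sigma_good.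
have r0L : red 0 \in L by rewrite mem_rcons mem_head.
apply/and4P; split; first exact: perm_s.
- have sz : 0 < size (exits true).
    rewrite size_exits //; have := exit_mem sigma_good r0L.
    by case: (exits _).
  have [w [wL _ wC _ wR]] := rank_onto sz.
  case E: s => [|x t] //.
  have xL : x \in L by rewrite -mem_s E mem_head.
  have := @index_key_le x w xL wL; rewrite E /= eqxx => /(_ isT).
  by rewrite /key_le wR wC /=; case: (color x); lia.
- have top x : x \in L -> key_le x (red 0).
    move=> xL; have k0 := crossing_red0 sigma_good.
    (* Since [blue 0] is listed last among the exits, [red 0] has the largest rank; being red of
       depth 0, it is the maximum of the order. *)
    have R0 : rank (red 0) = (size (exits false)).-1.
      rewrite /rank exit_crossing // s0 (exits_free_rows sigma_good noncrossing_rooks_sorted).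
      rewrite cats1 size_rcons -cats1 index_cat /= addn0.
      by rewrite mem_filter mem_row_labels andbF.
    have := rank_lt sigma_good xL; rewrite /key_le R0 (depth_crossing n k k0).
    by have := size_exits sigma_good; case: (color x) => /=; lia.
  have l0 : last (red 0) s \in L.
    by rewrite -mem_s; move: (mem_s (red 0)); rewrite r0L; case: (s) => //= a t _; apply: mem_last.
  apply/eqP; apply: (key_le_anti sigma_good) => //; first exact: top.
  have last_max t : uniq t -> red 0 \in t -> index (red 0) t <= index (last (red 0) t) t.
    case: t => // a t ut at_; rewrite [last _ _]/(last a t) index_last //.
    by rewrite -ltnS; move: at_; rewrite -index_mem.
  by apply: index_key_le => //; apply: last_max; rewrite ?mem_s.
- apply/(sorted_consecutive _ uniq_s) => x y xy; apply/implyP => /eqP C.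
  have /andP[] := consecutive_mem xy; rewrite !mem_s => xL yL.
  have := consecutive_sigma xy C; case cx: (color x) => -[_ E].
    by have := sl x xL; rewrite /legal /= E C eqxx -C cx.
  by have := sl y yL; rewrite /legal /= E C eqxx -C cx.
Qed.

Lemma map_sigma_crossing (c : bool) :
  map sigma [seq x <- s | crossing x && (color x == c)] = exits (~~ c).
Proof.
set A := [seq x <- s | _].
have memA x : x \in A -> [/\ x \in L, crossing x & color x = c].
  by rewrite mem_filter mem_s => /andP[/andP[? /eqP ?] ?].
have ranks : map (index^~ (exits (~~ c))) (map sigma A) = map rank A.
  rewrite -map_comp; apply/eq_in_map => x /memA [xL cx E] /=.
  by rewrite /rank exit_crossing // E.
have P : perm_eq (map sigma A) (exits (~~ c)).
  rewrite perm_sym (permPl (perm_exits sigma_good _)) negbK perm_map //.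
  by rewrite perm_filter // perm_sym.
have R : map rank A = iota 0 (size (exits (~~ c))).
  (* Within one color the key order refines the order of ranks, and the ranks permute an initial
     interval; a sorted permutation of it is the interval itself. *)
  apply: (sorted_eq leq_trans anti_leq).
  - rewrite sorted_map; apply: (@sub_in_sorted _ [in A] key_le); last first.
    + by apply: sorted_filter; first exact: key_le_trans.
    + by apply/allP.
    move=> x y /memA [_ _ cx] /memA [_ _ cy]; rewrite /key_le cx cy /=; case: (c); lia.
  - exact: iota_sorted.
  - by rewrite -ranks -map_index_uniq ?uniq_exits // perm_map.
apply: (@eq_from_nth _ (blue 0)); first exact: perm_size.
move=> i lt; have lt' : i < size (exits (~~ c)) by rewrite -(perm_size P).
have mi : nth (blue 0) (map sigma A) i \in exits (~~ c) by rewrite -(perm_mem P) mem_nth.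
rewrite -[LHS](nth_index (blue 0) mi); congr nth.
rewrite -(nth_map _ 0 (index^~ (exits (~~ c)))) // ranks R nth_iota //.
Qed.

Lemma sorted_word_placement :
  exists R, [/\ step2 n k (step1 s) (take (n + k).+1 s) = Some R, valid n k R &
    forall x, x \in col_labels n k -> (x, sigma x) \in R].
Proof.
have [_ _ s0 _] := sigma_good.
have [R [e P V]] := word_placement sorted_word_is_word.
exists R; split=> // x xC; rewrite (perm_mem P).
have NR := noncrossing_rooks_sorted.
case: (boolP (crossing x)) => cx; last by rewrite mem_cat NR xC cx eqxx.
have [s' Es Ps] := is_word_rcons sorted_word_is_word.
have Et : take (n + k).+1 s = s'.
  by rewrite -(size_col_labels n k) -(perm_size Ps) Es -cats1 take_size_cat.
rewrite Et.
(* Dropping the closing [red 0] and its image [blue 0] from the crossing letters and the exits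
   leaves the two lists that the greedy step zips. *)
have H c : map sigma (empty_cols (step1 s) c s') = free_rows n k (step1 s) c.
  have := map_sigma_crossing c; rewrite {1}Es (filter_crossing sigma_good NR) //.
  rewrite (exits_free_rows sigma_good NR) negbK map_cat.
  by case: c => /=; rewrite ?s0 ?cats0 // !cats1 => /rcons_inj [].
have xe : x \in empty_cols (step1 s) (color x) s'.
  by rewrite mem_filter (perm_mem Ps) xC (mem_cols_noncrossing NR) // cx eqxx.
rewrite -!H !zip_map_graph !mem_cat.
by case: (color x) xe => xe; rewrite (map_f (fun x => (x, sigma x)) xe) !orbT.
Qed.

End SortedWord.

(** * Placements and permutations *)

(* The default value makes [row_of R (red 0) = blue 0], since [red 0] labels
   no column. *)
Definition row_of (R : seq rook) (x : letter) : letter :=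
  nth (blue 0) (map snd R) (index x (map fst R)).

Lemma row_of_rook (n k : nat) (R : seq rook) (x : letter) :
  valid n k R -> x \in col_labels n k -> (x, row_of R x) \in R.
Proof.
case/and3P => PC _ _; rewrite -(perm_mem PC) => xR.
have lt : index x (map fst R) < size R by rewrite -(size_map fst) index_mem.
have := mem_nth (x, x) lt; rewrite /row_of (nth_map (x, x)) //.
have : (nth (x, x) R (index x (map fst R))).1 = x by rewrite -(nth_map _ x) // nth_index.
by case: (nth _ _ _) => a b /= ->.
Qed.

Lemma row_of_unique (n k : nat) (R : seq rook) (x y : letter) :
  valid n k R -> (x, y) \in R -> y = row_of R x.
Proof.
move=> V xy; have /and3P[PC _ _] := V.
apply: (uniq_fst_inj _ xy); first by rewrite (perm_uniq PC) uniq_col_labels.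
by apply: row_of_rook V _; rewrite -(perm_mem PC); apply/mapP; exists (x, y).
Qed.

(** Sending [red 0] to [blue 0] preserves injectivity because [blue 0] labels no row. *)
Lemma row_of_good (n k : nat) (R : seq rook) : valid n k R -> good n k (row_of R).
Proof.
move=> V; have /and3P[PC PR LR] := V.
have s0 : row_of R (red 0) = blue 0.
  rewrite /row_of nth_default // memNindex ?size_map //.
  by rewrite (perm_mem PC) mem_col_labels.
have colP x : x \in all_letters n k -> x = red 0 \/ x \in col_labels n k.
  by rewrite mem_rcons inE => /orP[/eqP|]; [left|right].
have rowP x : x \in col_labels n k -> row_of R x \in row_labels n k.
  move=> xC; rewrite -(perm_mem PR); apply/mapP.
  by exists (x, row_of R x) => //; apply: row_of_rook V _.
have b0 : blue 0 \notin row_labels n k by rewrite mem_row_labels.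
split=> // [x /colP xL|x y /colP xL /colP yL|x /colP [->|xC]].
- rewrite (perm_mem (perm_row_labels n k)) mem_rcons inE.
  by case: xL => [->|/rowP ->]; rewrite ?s0 ?eqxx ?orbT.
- case: xL yL => [->|xC] [->|yC] //; rewrite ?s0 => E.
  + by move: (rowP y yC); rewrite -E (negPf b0).
  + by move: (rowP x xC); rewrite E (negPf b0).
  have yR := row_of_rook V yC; rewrite -E in yR.
  apply: (uniq_snd_inj _ (row_of_rook V xC) yR).
  by rewrite (perm_uniq PR) uniq_row_labels.
- by rewrite s0.
by apply: (allP LR); apply: row_of_rook V _.
Qed.

(** * Labels as board coordinates *)

Lemma nth_col_labels (n k i : nat) : i < (n + k).+1 ->
  nth (red 0) (col_labels n k) i = if i < n then red (n - i) else blue (n + k - i).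
Proof.
move=> lt; rewrite nth_cat size_map size_rev size_iota; case: ltnP => h.
  rewrite (nth_map 0) ?size_rev ?size_iota // nth_rev ?size_iota // nth_iota; last lia.
  by congr (true, _); lia.
rewrite (nth_map 0) ?size_rev ?size_iota; last lia.
rewrite nth_rev ?size_iota; last lia.
by rewrite nth_iota; [congr (false, _); lia | lia].
Qed.

Lemma nth_row_labels (n k j : nat) : j < (n + k).+1 ->
  nth (red 0) (rev (row_labels n k)) j =
  if j <= n then red (n - j) else blue ((n + k).+1 - j).
Proof.
move=> lt; rewrite nth_rev ?size_row_labels // nth_cat size_map size_iota.
case: (leqP j n) => h.
  rewrite ifF; last lia.
  rewrite (nth_map 0) ?size_iota; last lia.
  by rewrite nth_iota; [congr (true, _); lia | lia].
rewrite ifT; last lia.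
rewrite (nth_map 0) ?size_iota; last lia.
by rewrite nth_iota; [congr (false, _); lia | lia].
Qed.

(** Labels of one color decrease from left to right and from bottom to top, so comparing them
    compares [i] and [j]. For different colors, [n] separates the coordinates. *)
Lemma legal_excedance (n k i j : nat) : i < (n + k).+1 -> j < (n + k).+1 ->
  legal (nth (red 0) (col_labels n k) i, nth (red 0) (rev (row_labels n k)) j) =
  ((i < j) == (i < n)).
Proof.
move=> hi hj; rewrite /legal /= nth_col_labels // nth_row_labels //.
by case: (ltnP i n) => hin; case: (leqP j n) => hjn /=; lia.
Qed.

Lemma is_EP (n k : nat) (lambda : 'S_((n + k).+1)) :
  reflect (forall i : 'I_((n + k).+1), (i < lambda i) = (i < n)) (is_E n k lambda).
Proof.
apply: (iffP eqP) => [/setP H i|H]; first by have := H i; rewrite !inE.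
by apply/setP => i; rewrite !inE H.
Qed.

Lemma valid_rooks_of_perm (n k : nat) (lambda : 'S_((n + k).+1)) :
  is_E n k lambda -> valid n k (rooks_of_perm n k lambda).
Proof.
move/is_EP => H; apply/and3P; split.
- rewrite -map_comp (eq_map (g := nth (red 0) (col_labels n k) \o val)) // map_comp.
  by rewrite val_enum_ord -(size_col_labels n k) -/(mkseq _ _) mkseq_nth.
- rewrite -map_comp.
  rewrite (eq_map (g := nth (red 0) (rev (row_labels n k)) \o val \o lambda)) //.
  rewrite 2!map_comp.
  have P : perm_eq (map lambda (enum 'I_(n + k).+1)) (enum 'I_(n + k).+1).
    apply: uniq_perm; [rewrite map_inj_uniq ?enum_uniq // | exact: enum_uniq | ].
      exact: perm_inj.
    move=> i; rewrite mem_enum inE; apply/mapP; exists ((lambda^-1)%g i); rewrite ?mem_enum //.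
    by rewrite permKV.
  rewrite (permPl (perm_map _ (perm_map _ P))) val_enum_ord.
  by rewrite -(size_row_labels n k) -(size_rev (row_labels n k)) -/(mkseq _ _) mkseq_nth perm_rev.
- by apply/allP => _ /mapP[i _ ->]; rewrite legal_excedance // H.
Qed.

Lemma rooks_of_perm_inj (n k : nat) (lambda mu : 'S_((n + k).+1)) :
  rooks_of_perm n k lambda =i rooks_of_perm n k mu -> lambda = mu.
Proof.
move=> H; apply/permP => i.
have : (nth (red 0) (col_labels n k) i,
        nth (red 0) (rev (row_labels n k)) (lambda i)) \in rooks_of_perm n k mu.
  by rewrite -H; apply/mapP; exists i; rewrite ?mem_enum.
case/mapP => j _ [/eqP + /eqP]; rewrite !nth_uniq ?size_col_labels ?uniq_col_labels //;
  rewrite ?size_rev ?size_row_labels ?rev_uniq ?uniq_row_labels //.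
by move=> /eqP/val_inj -> /eqP/val_inj.
Qed.

Lemma perm_of_valid (n k : nat) (R : seq rook) : valid n k R ->
  exists2 lambda, is_E n k lambda & R =i rooks_of_perm n k lambda.
Proof.
move=> V; have /and3P[PC PR LR] := V; have [_ si _ _] := row_of_good V.
pose row (i : 'I_(n + k).+1) := row_of R (nth (red 0) (col_labels n k) i).
have colP (i : 'I_(n + k).+1) : nth (red 0) (col_labels n k) i \in col_labels n k.
  by rewrite mem_nth ?size_col_labels.
have rowP i : row i \in rev (row_labels n k).
  rewrite mem_rev -(perm_mem PR); apply/mapP; eexists; [exact: row_of_rook V (colP i) | by []].
have lt i : index (row i) (rev (row_labels n k)) < (n + k).+1.
  by rewrite -[X in _ < X](size_row_labels n k) -(size_rev (row_labels n k)) index_mem.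
pose f i : 'I_(n + k).+1 := Ordinal (lt i).
have nth_f i : nth (red 0) (rev (row_labels n k)) (f i) = row i by rewrite /= nth_index.
have f_inj : injective f.
  move=> i j E; have : row i = row j by rewrite -!nth_f E.
  move/si; rewrite !mem_rcons !inE !colP !orbT => /(_ isT isT) /eqP.
  by rewrite nth_uniq ?size_col_labels ?uniq_col_labels // => /eqP/val_inj.
exists (perm f_inj).
  apply/is_EP => i; rewrite permE.
  have : legal (nth (red 0) (col_labels n k) i, row i).
    by apply: (allP LR); apply: row_of_rook V _.
  by rewrite -nth_f legal_excedance // => /eqP.
move=> [x y]; apply/idP/mapP => [xy|[i _ [-> ->]]]; last first.
  by rewrite permE nth_f; apply: row_of_rook V _.
have xC : x \in col_labels n k by rewrite -(perm_mem PC); apply/mapP; exists (x, y).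
have xlt : index x (col_labels n k) < (n + k).+1 by rewrite -(size_col_labels n k) index_mem.
exists (Ordinal xlt); rewrite ?mem_enum // permE nth_f /row /= nth_index //.
by rewrite (row_of_unique V xy).
Qed.

(** * Bijectivity of the procedure *)

Lemma rook_placement_inj (n k : nat) (S T : seq letter * seq letter) (Q R : seq rook) :
  is_C n k S -> is_C n k T ->
  rook_placement n k S = Some Q -> rook_placement n k T = Some R -> Q =i R -> S = T.
Proof.
rewrite /rook_placement => CS CT; have WS := CS; have WT := CT; rewrite !is_word_full_string in WS WT.
have [Q' [-> PQ VQ]] := word_placement WS; have [R' [-> PR VR]] := word_placement WT.
move=> [<-] [<-] QR.
have sg := row_of_good VQ; have rg x := @row_of_rook n k Q' x VQ.
have sS := word_sorted sg WS PQ VQ rg.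
(* Both placements have the same rooks, so the order built from [Q'] also sorts the second string;
   two sorted arrangements of the same letters coincide. *)
have sT : sorted (key_le n k (row_of Q')) (full_string T).
  by apply: (word_sorted sg WT PR VR) => x /rg; rewrite QR.
have /and4P[PS _ _ _] := WS; have /and4P[PT _ _ _] := WT.
apply: (full_string_inj CS CT).
apply: (sorted_eq_in _ _ sS sT).
- by move=> x y z _ _ _; apply: key_le_trans.
- by move=> x y; rewrite !(perm_mem PS) => xL yL /andP[]; apply: (key_le_anti sg).
by rewrite (permPl PS) perm_sym.
Qed.

Lemma rook_placement_surj (n k : nat) (lambda : 'S_((n + k).+1)) : is_E n k lambda ->
  exists S R, [/\ is_C n k S, rook_placement n k S = Some R & R =i rooks_of_perm n k lambda].
Proof.
move=> /valid_rooks_of_perm V; have sg := row_of_good V.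
have [S CS ES] := is_word_full_stringP (sorted_word_is_word sg).
have [R [eR VR sub]] := sorted_word_placement sg.
exists S, R; split=> //; first by rewrite /rook_placement ES.
have C Q x y : valid n k Q -> (x, y) \in Q -> x \in col_labels n k.
  by case/and3P => PC _ _ xy; rewrite -(perm_mem PC); apply/mapP; exists (x, y).
move=> [x y]; apply/idP/idP => xy; last first.
  by rewrite (row_of_unique V xy); apply: sub; apply: C V xy.
have xC := C _ _ _ VR xy; rewrite (row_of_unique VR xy) -(row_of_unique VR (sub x xC)).
exact: row_of_rook V xC.
Qed.

Lemma rook_placement_perm (n k : nat) (S : seq letter * seq letter) : is_C n k S ->
  exists R, [/\ rook_placement n k S = Some R, size R = (n + k).+1, nonattacking R &
    exists2 lambda, is_E n k lambda & R =i rooks_of_perm n k lambda].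
Proof.
rewrite is_word_full_string => /word_placement [R [e _ V]]; exists R; split=> //.
- by have /and3P[PC _ _] := V; rewrite -(size_map fst) (perm_size PC) size_col_labels.
- have /and3P[PC PR _] := V.
  by rewrite /nonattacking (perm_uniq PC) (perm_uniq PR) uniq_col_labels uniq_row_labels.
exact: perm_of_valid.
Qed.

Theorem theorem4p6 (n k : nat) :
  exists Phi : C n k -> E n k,
    (forall S : C n k,
       exists R : seq rook,
         [/\ rook_placement n k (val S) = Some R,
             size R = (n + k).+1,
             nonattacking R
           & R =i rooks_of_perm n k (val (Phi S))]) /\
    bijective Phi.
Proof.
(* The relation is made boolean so that [xchoose] can extract a function from a mere existence
   statement. *)
pose P (S : C n k) (lambda : E n k) :=
  if rook_placement n k (val S) is Some R
  then all [in R] (rooks_of_perm n k (val lambda)) && all [in rooks_of_perm n k (val lambda)] R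
  else false.
have PP S lambda R : rook_placement n k (val S) = Some R ->
    P S lambda <-> R =i rooks_of_perm n k (val lambda).
  rewrite /P => ->; split=> [/andP[/allP H1 /allP H2] x|H].
    by apply/idP/idP; [apply: H2 | apply: H1].
  by apply/andP; split; apply/allP => x; rewrite /= H.
have ex S : exists lambda, P S lambda.
  have [R [e _ _ [lambda El H]]] := rook_placement_perm (valP S).
  by exists (exist _ lambda El); apply/(PP _ _ _ e).
pose Phi S := xchoose (ex S); exists Phi.
have PhiP S R : rook_placement n k (val S) = Some R -> R =i rooks_of_perm n k (val (Phi S)).
  by move=> e; apply/(PP _ _ _ e); apply: xchooseP.
split=> [S|].
  have [R [e sR nR _]] := rook_placement_perm (valP S).
  by exists R; split=> //; apply: PhiP.
have Phi_inj : injective Phi.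
  move=> S T E; have [R [eR _ _ _]] := rook_placement_perm (valP S).
  have [Q [eQ _ _ _]] := rook_placement_perm (valP T).
  apply/val_inj/(rook_placement_inj (valP S) (valP T) eR eQ) => x.
  by rewrite (PhiP _ _ eR) (PhiP _ _ eQ) E.
have Phi_surj lambda : exists S, Phi S == lambda.
  have [S [R [CS e H]]] := rook_placement_surj (valP lambda).
  exists (exist _ S CS); apply/eqP/val_inj/rooks_of_perm_inj => x.
  by rewrite -(PhiP (exist _ S CS) R e) H.
(* Choosing preimages gives a right inverse, and injectivity of [Phi] makes it two-sided. *)
have PhiK lambda : Phi (xchoose (Phi_surj lambda)) = lambda by apply/eqP/(xchooseP (Phi_surj lambda)).
by exists (fun lambda => xchoose (Phi_surj lambda)) => // S; apply: Phi_inj.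
Qed.
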